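(* Let $\mathcal H$ be a real separable Hilbert space with Hilbertian basis $(e_n)_{n\in\mathbb N}$, and let $H\in\mathcal C^1(\mathbb R,\mathcal L_2(\mathcal H))$. Write $h_{i,j}(t)=\langle H(t)e_i,e_j\rangle$. Assume: (i) the function $t\mapsto \|H(t)\|_{\mathsf{HS}}$ is bounded on $\mathbb R$; (ii) the family $(h_{i,j})_{i,j\in\mathbb N}$ is balanced; (iii) there exists a pointwise bounded and balanced family of measurable real-valued functions $(g_{i,j})_{i,j\in\mathbb N}$ on $\mathbb R$ such that $$\forall i\in\mathbb N,\ \forall t\in\mathbb R,\qquad h_{i,i}'(t)=\sum_{j=0}^{+\infty}g_{i,j}(t)\,|h_{i,j}(t)|^2 .$$ Suppose there exist $T>0$ and a sign sequence $(\epsilon_\ell)_{\ell\in\mathbb N}\in\{-1,1\}^{\mathbb N}$ such that $$\forall t\geq T,\ \forall k,\ell\in\mathbb N \text{ with } k\geq \ell,\qquad \epsilon_\ell\, g_{\ell,k}(t)\geq 0 .$$ Then for every $\ell\in\mathbb N$, $$\sum_{j=0}^{+\infty}\int_T^{+\infty}|g_{\ell,j}(t)|\,|h_{\ell,j}(t)|^2\,\mathrm dt<+\infty,$$ and every diagonal term $h_{\ell,\ell}(t)$ converges as $t\to+\infty$ to a real limit $h_{\ell,\ell}(\infty)$. If in addition $$\forall \ell\in\mathbb N,\ \exists c_\ell>0,\ \forall j\neq\ell,\ \forall t\geq T,\qquad |g_{\ell,j}(t)|\geq c_\ell,$$ then for every $\ell\in\mathbb N$, $$\sum_{j\neq\ell}\int_T^{+\infty}|h_{\ell,j}(t)|^2\,\mathrm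 dt=\int_T^{+\infty}\|H(t)e_\ell-h_{\ell,\ell}(t)e_\ell\|^2\,\mathrm dt<+\infty .$$ If moreover, for every $\ell\in\mathbb N$, the function $t\mapsto\|H'(t)e_\ell\|$ is bounded, then for every $\ell\in\mathbb N$, $H(t)e_\ell\to h_{\ell,\ell}(\infty)\,e_\ell$ in $\mathcal H$ as $t\to+\infty$.
   Context: $\mathcal L_2(\mathcal H)$ denotes the space of Hilbert-Schmidt operators on $\mathcal H$ with norm $\|H\|_{\mathsf{HS}}^2=\sum_n\|He_n\|^2$. A family of real-valued functions $(g_{i,j})_{i,j\in\mathbb N}$ defined on $\mathbb R$ is called balanced if for all $i,j\in\mathbb N$ there exists $c_{i,j}\in L^\infty(\mathbb R,\mathbb R_+)$ such that $|g_{i,j}(t)|\leq c_{i,j}(t)|g_{j,i}(t)|$ for all $t\in\mathbb R$. It is called pointwise bounded if for all $t\in\mathbb R$, $\sup_{i,j}|g_{i,j}(t)|<+\infty$. *)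

(* Defs.v *)
From HB Require Import structures.
From mathcomp Require Import all_boot all_order all_algebra.
From mathcomp Require Import all_classical all_reals all_analysis.
Set Implicit Arguments. Unset Strict Implicit. Unset Printing Implicit Defensive.
Import Order.TTheory GRing.Theory Num.Theory.
Import numFieldNormedType.Exports.
Local Open Scope classical_set_scope.
Local Open Scope ring_scope.

Section Hilbert.
Context {R : realType} {V : normedModType R}.

Definition inner_product (ip : V -> V -> R) : Prop :=
  [/\ forall x y, ip x y = ip y x,
      forall (a : R) x y z, ip (a *: x + y) z = a * ip x z + ip y z
    & forall x, `|x| = Num.sqrt (ip x x)].

Definition hilbert_basis (ip : V -> V -> R) (e : nat -> V) : Prop :=
  (forall i j, ip (e i) (e j) = (i == j)%:R) /\
  (forall x, (fun N => \sum_(n < N) ip x (e n) *: e n) @ \oo --> x).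

Definition hs_norm2 (e : nat -> V) (A : V -> V) : \bar R :=
  (\sum_(0 <= n <oo) (`|A (e n)| ^+ 2)%:E)%E.

(* Hilbert-Schmidt norm (meaningful when hs_norm2 is finite) *)
Definition hs_norm (e : nat -> V) (A : V -> V) : R :=
  Num.sqrt (fine (hs_norm2 e A)).

Definition hilbert_schmidt (e : nat -> V) (A : V -> V) : Prop :=
  [/\ forall (a : R) x y, A (a *: x + y) = a *: A x + A y,
      continuous A
    & (hs_norm2 e A < +oo)%E].

Definition C1_HS (e : nat -> V) (H H' : R -> V -> V) : Prop :=
  [/\ forall t, hilbert_schmidt e (H t),
      forall t, hilbert_schmidt e (H' t),
      forall t, hs_norm e (fun x => s^-1 *: (H (t + s) x - H t x) - H' t x)
                  @[s --> 0^'] --> 0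
    & forall t, hs_norm e (fun x => H' s x - H' t x) @[s --> t] --> 0].

End Hilbert.

Section Families.
Context {R : realType}.

Definition balanced_family (g : nat -> nat -> R -> R) : Prop :=
  forall i j, exists c : R -> R,
    [/\ measurable_fun setT c,
        forall t, 0 <= c t,
        exists M : R, {ae (@lebesgue_measure R), forall t, c t <= M}
      & forall t, `|g i j t| <= c t * `|g j i t|].

Definition pointwise_bounded_family (g : nat -> nat -> R -> R) : Prop :=
  forall t, exists M : R, forall i j, `|g i j t| <= M.

End Families.

(* Main.v *)
Require Import Defs.
From HB Require Import structures.
From mathcomp Require Import all_boot all_order all_algebra.
From mathcomp Require Import all_classical all_reals all_analysis.
From mathcomp Require Import measurable_realfun ring lra.
Import Order.TTheory GRing.Theory Num.Theory.
Import numFieldNormedType.Exports.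
Local Open Scope classical_set_scope.
Local Open Scope ring_scope.

(** Write [w l j = |g l j| * h l j ^+ 2]. By the sign condition, for [t >= T] the
    series for [eps l * (h l l)'] has terms [w l j] for [j >= l], so
    [\sum_j w l j <= eps l * (h l l)' + 2 * \sum_(j < l) w l j]. Since [g] and
    [h] are balanced, [w l j] is a.e. at most a constant times [w j l], which is
    integrable by strong induction when [j < l]; as [h l l] is bounded,
    integrating this inequality over [[T, x]] bounds [\sum_j \int w l j], and
    [eps l * h l l] plus a bounded nondecreasing function is nondecreasing,
    so [h l l] converges. The lower bound on [|g l j|] and Parseval's identity
    then make the square of [|H t (e l) - h l l t *: e l|] integrable, and this
    Lipschitz function tends to 0 by Barbalat's argument. *)

(** * Real inner products: bilinearity, Cauchy-Schwarz, continuity *)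

Section InnerProduct.
Context {R : realType} {V : normedModType R} (ip : V -> V -> R).
Hypothesis Hip : inner_product ip.

Lemma ipC x y : ip x y = ip y x.
Proof. by case: Hip. Qed.

Lemma ipPl (a : R) x y z : ip (a *: x + y) z = a * ip x z + ip y z.
Proof. by case: Hip. Qed.

Lemma ip0l z : ip 0 z = 0.
Proof. by have := ipPl 1 0 0 z; rewrite scaler0 addr0; lra. Qed.

Lemma ipDl x y z : ip (x + y) z = ip x z + ip y z.
Proof. by rewrite -[x]scale1r ipPl mul1r scale1r. Qed.

Lemma ipZl (a : R) x z : ip (a *: x) z = a * ip x z.
Proof. by rewrite -[a *: x]addr0 ipPl ip0l addr0. Qed.

Lemma ipBl x y z : ip (x - y) z = ip x z - ip y z.
Proof. by rewrite -scaleN1r ipDl ipZl mulN1r. Qed.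

Lemma ipDr x y z : ip z (x + y) = ip z x + ip z y.
Proof. by rewrite ipC ipDl !(ipC _ z). Qed.

Lemma ipZr (a : R) x z : ip z (a *: x) = a * ip z x.
Proof. by rewrite ipC ipZl ipC. Qed.

Lemma ipBr x y z : ip z (x - y) = ip z x - ip z y.
Proof. by rewrite ipC ipBl !(ipC _ z). Qed.

Lemma ip_sumr (I : Type) (r : seq I) (f : I -> V) z :
  ip z (\sum_(i <- r) f i) = \sum_(i <- r) ip z (f i).
Proof.
elim/big_ind2 : _ => //; first by rewrite ipC ip0l.
by move=> x1 x2 y1 y2 <- <-; rewrite ipDr.
Qed.

(** Positivity comes from the norm formula: [Num.sqrt] vanishes on negative reals, so [ip x x < 0]
    would force [x = 0]. *)
Lemma ip_ge0 x : 0 <= ip x x.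
Proof.
rewrite leNgt; apply/negP => xx0; case: Hip => _ _ Hn.
have : `|x| = 0 by rewrite Hn ler0_sqrtr // ltW.
by move/normr0_eq0 => x0; move: xx0; rewrite x0 ip0l ltxx.
Qed.

Lemma ip_norm x : ip x x = `|x| ^+ 2.
Proof. by case: (Hip) => _ _ ->; rewrite sqr_sqrtr // ip_ge0. Qed.

Lemma cauchy_schwarz_ip x y : `|ip x y| <= `|x| * `|y|.
Proof.
have [->|y0] := eqVneq y 0; first by rewrite ipC ip0l !normr0 mulr0.
have ny : 0 < `|y| by rewrite normr_gt0.
rewrite -(ler_pXn2r (n := 2)) // ?nnegrE ?mulr_ge0 // real_normK ?num_real //.
(* This vector is the residual of projecting [x] on [y], scaled to avoid division; its square
   expands to [|y|^2 (|x|^2 |y|^2 - (ip x y)^2)]. *)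
have := ip_ge0 (`|y| ^+ 2 *: x - ip x y *: y).
rewrite ipBl !ipBr !ipZl !ipZr (ipC y x) !ip_norm => H.
have {}H : 0 <= `|y| ^+ 2 * ((`|x| * `|y|) ^+ 2 - ip x y ^+ 2) by move: H; lra.
by move: H; rewrite pmulr_rge0 ?exprn_gt0 // subr_ge0.
Qed.

Lemma cvg_ipl {I : Type} {F : set_system I} {FF : Filter F} (f : I -> V) x y :
  f @ F --> x -> ip (f i) y @[i --> F] --> ip x y.
Proof.
move=> fx; apply/cvgrPdist_le => _/posnumP[d].
have y1 : 0 < `|y| + 1 by rewrite ltr_wpDl.
have d1 : 0 < d%:num / (`|y| + 1) by rewrite divr_gt0.
move/cvgrPdist_le : fx => /(_ _ d1); apply: filterS => i H.
rewrite -ipBl (le_trans (cauchy_schwarz_ip _ _))//.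
move: H; rewrite ler_pdivlMr // => /(le_trans _); apply.
by rewrite ler_wpM2l // lerDl.
Qed.

(** * Hilbertian bases: Parseval and orthogonal complements *)

Variable e : nat -> V.
Hypothesis He : hilbert_basis ip e.

(** Each partial sum is [ip s x] with [s] the partial expansion of [x]; as [s] tends to [x],
    continuity of [ip] gives [ip x x]. *)
Lemma parseval x :
  (\sum_(0 <= n <oo) (ip x (e n) ^+ 2)%:E)%E = (`|x| ^+ 2)%:E.
Proof.
apply/cvg_lim => //.
have -> : (fun N => \sum_(0 <= n < N) (ip x (e n) ^+ 2)%:E)%E =
  EFin \o (fun N => ip (\sum_(n < N) ip x (e n) *: e n) x).
  apply/funext => N /=; rewrite sumEFin big_mkord ipC ip_sumr.
  by congr EFin; apply: eq_bigr => i _; rewrite ipZr expr2.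
apply: cvg_EFin; first exact: nearW.
by rewrite -ip_norm; apply: cvg_ipl; case: He.
Qed.

Lemma norm_basis n : `|e n| = 1.
Proof.
case: Hip => _ _ ->; case: He => -> _.
by rewrite eqxx sqrtr1.
Qed.

(** Parseval for the projected vector: its coefficient on [e l] vanishes and the others are those of
    [x]. *)
Lemma parseval_proj_compl x l :
  (\sum_(0 <= n <oo | n != l) (ip x (e n) ^+ 2)%:E)%E
  = (`|x - ip x (e l) *: e l| ^+ 2)%:E.
Proof.
rewrite -parseval eseries_mkcond; apply: eq_eseriesr => n _.
rewrite ipBl ipZl; case: He => -> _; rewrite (eq_sym l).
by case: eqVneq => [->|_] /=; rewrite ?mulr1 ?subrr ?expr0n //= mulr0 subr0.
Qed.

(** Pythagoras: the squared norms differ by [ip x (e l) ^+ 2]. This contraction later makes the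
    off-diagonal part of [H t (e l)] Lipschitz. *)
Lemma norm_proj_compl x l : `|x - ip x (e l) *: e l| <= `|x|.
Proof.
rewrite -(ler_pXn2r (n := 2)) // ?nnegrE // -!ip_norm.
rewrite ipBl !ipBr !ipZl !ipZr !(ipC (e l)) (ip_norm (e l)) norm_basis.
by have := sqr_ge0 (ip x (e l)); lra.
Qed.

(** * Hilbert-Schmidt norms *)

Lemma hs_norm2_ge0 (A : V -> V) : (0 <= hs_norm2 e A)%E.
Proof. by apply: nneseries_ge0 => n _ _; rewrite lee_fin sqr_ge0. Qed.

(** Termwise, [|a A + B|^2 <= 2 a^2 |A|^2 + 2 |B|^2]. Finiteness matters because [fine] sends [+oo]
    to 0, so a small [hs_norm] alone controls nothing. *)
Lemma hs_norm2_lty_lin (a : R) (A B : V -> V) :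
  (hs_norm2 e A < +oo -> hs_norm2 e B < +oo ->
   hs_norm2 e (fun x => (a *: A x + B x)%R) < +oo)%E.
Proof.
move=> hA hB.
pose C n := ((2 * a ^+ 2)%:E * (`|A (e n)| ^+ 2)%:E
             + 2%:E * (`|B (e n)| ^+ 2)%:E)%E.
apply: (@le_lt_trans _ _ (\sum_(0 <= n <oo) C n)%E).
  apply: lee_nneseries => n _; first by rewrite lee_fin sqr_ge0.
  rewrite /C -!EFinM -EFinD lee_fin.
  have H := ler_normD (a *: A (e n)) (B (e n)).
  have {}H : `|a *: A (e n) + B (e n)| ^+ 2
             <= (`|a *: A (e n)| + `|B (e n)|) ^+ 2.
    by rewrite lerXn2r // nnegrE ?addr_ge0.
  rewrite (le_trans H)// normrZ -[a ^+ 2]real_normK ?num_real //.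
  by have := sqr_ge0 (`|a| * `|A (e n)| - `|B (e n)|); lra.
have a2 : 0 <= 2 * a ^+ 2 by rewrite mulr_ge0 // sqr_ge0.
rewrite nneseriesD; last 2 first.
- by move=> n _; rewrite -EFinM lee_fin mulr_ge0 // sqr_ge0.
- by move=> n _; rewrite -EFinM lee_fin mulr_ge0 // sqr_ge0.
rewrite !nneseriesZl; try by move=> n _; rewrite lee_fin sqr_ge0.
have fin (D : V -> V) : (hs_norm2 e D < +oo)%E -> hs_norm2 e D \is a fin_num.
  by move=> hD; rewrite ge0_fin_numE // hs_norm2_ge0.
by rewrite lte_add_pinfty // lte_mul_pinfty // ?fin ?lee_fin.
Qed.

(** A nonnegative series dominates each of its terms. This turns limits in [hs_norm] into limits of
    the vectors [A (e n)]. *)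
Lemma norm_le_hs_norm (A : V -> V) n :
  (hs_norm2 e A < +oo)%E -> `|A (e n)| <= hs_norm e A.
Proof.
move=> hA; have fA : hs_norm2 e A \is a fin_num.
  by rewrite ge0_fin_numE // hs_norm2_ge0.
rewrite -[X in X <= _]ger0_norm // -sqrtr_sqr ler_wsqrtr //.
rewrite -lee_fin fineK //.
have := @nneseries_lim_ge R (fun n => (`|A (e n)| ^+ 2)%:E) xpredT 0%N n.+1.
rewrite big_mkord big_ord_recr /= => H; apply: le_trans (H _).
  by rewrite leeDr // sume_ge0 // => i _; rewrite lee_fin sqr_ge0.
by move=> k _ _; rewrite lee_fin sqr_ge0.
Qed.

(** * Matrix coefficients of a C^1 curve of Hilbert-Schmidt operators *)

Variables H H' : R -> V -> V.
Hypothesis HC1 : C1_HS e H H'.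

(** Hilbert-Schmidt convergence of the difference quotients gives norm convergence at [e l], hence
    convergence against [y]. *)
Lemma C1_HS_is_derive l y t :
  is_derive t (1 : R) (fun s => ip (H s (e l)) y) (ip (H' t (e l)) y).
Proof.
case: HC1 => hsH hsH' dH _.
suff Hc : s^-1 *: (ip (H (s *: (1 : R) + t) (e l)) y - ip (H t (e l)) y)
    @[s --> 0^'] --> ip (H' t (e l)) y.
  by apply: DeriveDef; [apply/cvg_ex; exists (ip (H' t (e l)) y)|exact/cvg_lim].
have Hv : s^-1 *: (H (t + s) (e l) - H t (e l)) @[s --> 0^'] --> H' t (e l).
  apply/cvgrPdist_le => _/posnumP[d].
  have /cvgrPdist_le/(_ _ (gt0 d)) := dH t; apply: filterS => s.
  rewrite sub0r normrN => Hs; rewrite distrC.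
  apply: le_trans (le_trans (ler_norm _) Hs).
  apply: (norm_le_hs_norm (fun x => s^-1 *: (H (t + s) x - H t x) - H' t x)).
  (* Nested shapes [a *: A x + B x] let [hs_norm2_lty_lin] prove finiteness; the final [+ 0] is the
     zero operator. *)
  have -> : (fun x => s^-1 *: (H (t + s) x - H t x) - H' t x) =
     (fun x => s^-1 *: ((-1) *: H t x + H (t + s) x) + ((-1) *: H' t x + 0)).
    by apply/funext => x; rewrite !scaleN1r addr0 [- _ + _]addrC.
  have h0 : (hs_norm2 e (fun=> 0%R) < +oo)%E.
    by rewrite /hs_norm2 eseries0 ?ltry // => n _ _; rewrite normr0 expr0n.
  apply: (hs_norm2_lty_lin s^-1 (fun x => (-1) *: H t x + H (t + s) x)).
    by apply: hs_norm2_lty_lin; [have [] := hsH t|have [] := hsH (t + s)].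
  by apply: (hs_norm2_lty_lin (-1) (H' t) (fun=> 0)) => //; have [] := hsH' t.
have Hc := cvg_ipl (F := 0^') _ _ y Hv;
have -> : (fun s : R => s^-1 *: (ip (H (s *: (1 : R) + t) (e l)) y
    - ip (H t (e l)) y)) = (fun s => ip (s^-1 *: (H (t + s) (e l) - H t (e l))) y).
  by apply/funext => s; rewrite ipZl ipBl [t + s]addrC [s *: _]mulr1.
exact: Hc.
Qed.

Lemma C1_HS_continuous_derive l y : continuous (fun t => ip (H' t (e l)) y).
Proof.
case: HC1 => _ hsH' _ cH' t; apply: cvg_ipl.
apply/cvgrPdist_le => _/posnumP[d].
have /cvgrPdist_le/(_ _ (gt0 d)) := cH' t; apply: filterS => s.
rewrite sub0r normrN => Hs; rewrite distrC.
apply: le_trans (le_trans (ler_norm _) Hs).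
apply: (norm_le_hs_norm (fun x => H' s x - H' t x)).
have -> : (fun x => H' s x - H' t x) = (fun x => (-1) *: H' t x + H' s x).
  by apply/funext => x; rewrite scaleN1r addrC.
by apply: hs_norm2_lty_lin; [have [] := hsH' t|have [] := hsH' s].
Qed.

Lemma C1_HS_continuous l y : continuous (fun t => ip (H t (e l)) y).
Proof.
move=> t; apply/differentiable_continuous/derivable1_diffP.
by have [] := C1_HS_is_derive l y t.
Qed.

(* The mean value theorem applied to [s |-> ip (H s (e l)) u] with
   [u = H x (e l) - H y (e l)] bounds [`|u| ^+ 2]. *)
Lemma C1_HS_lipschitz l M : (forall t, `|H' t (e l)| <= M) ->
  forall x y, `|H y (e l) - H x (e l)| <= M * `|y - x|.
Proof.
move=> HM.
have main x y : x <= y -> `|H y (e l) - H x (e l)| <= M * `|y - x|.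
  move=> xy; set u := H y (e l) - H x (e l).
  have [u0|u0] := eqVneq u 0.
    by rewrite u0 normr0 mulr_ge0 // (le_trans _ (HM 0)).
  have [||c _ Hc] := @MVT_segment _ (fun s => ip (H s (e l)) u)
    (fun s => ip (H' s (e l)) u) x y xy.
  - by move=> s _; exact: C1_HS_is_derive.
  - exact/continuous_subspaceT/C1_HS_continuous.
  have nu : 0 < `|u| by rewrite normr_gt0.
  rewrite -(ler_pM2l nu) -expr2 -ip_norm {1}/u ipBl Hc.
  apply: (le_trans (ler_norm _)); rewrite normrM mulrA ler_wpM2r //.
  by rewrite (le_trans (cauchy_schwarz_ip _ _)) // mulrC ler_wpM2l.
move=> x y; have [xy|/ltW yx] := leP x y; first exact: main.
by rewrite distrC (distrC y); exact: main.
Qed.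

End InnerProduct.

(** * Monotone limits and integrals on a half-line *)

Section HalfLine.
Context {R : realType}.
Notation mu := (@lebesgue_measure R).

Lemma nondecreasing_itvy_cvg (f : R -> R) (a M : R) :
  (forall x y, a <= x -> x <= y -> f x <= f y) -> (forall x, a <= x -> f x <= M) ->
  exists l : R, f x @[x --> +oo] --> l.
Proof.
(* [g] freezes [f] at [f a] to the left of [a]: it is monotone on the whole line and eventually
   equal to [f]. *)
move=> ndf fM; pose g x := f (Num.max a x).
exists (sup (range g)); have : g x @[x --> +oo] --> sup (range g).
  apply: nondecreasing_cvgr => [x y xy|].
    apply: ndf; first by rewrite le_max lexx.
    by rewrite ge_max !le_max lexx xy orbT.
  by exists M => _ [x _ <-]; apply: fM; rewrite le_max lexx.
apply: cvg_trans; apply: near_eq_cvg; near=> x.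
by rewrite /g max_r //; near: x; exact: nbhs_pinfty_ge.
Unshelve. all: by end_near. Qed.

Lemma integral_itvy_le (a : R) (f : R -> R) (C : \bar R) :
  measurable_fun `[a, +oo[ f -> (forall x, a <= x -> 0 <= f x) ->
  (forall x, (a < x)%R -> \int[mu]_(t in `[a, x]) (f t)%:E <= C)%E ->
  (\int[mu]_(t in `[a, +oo[) (f t)%:E <= C)%E.
Proof.
move=> mf f0 fC; have mEf : measurable_fun `[a, +oo[ (EFin \o f).
  exact/measurable_EFinP.
(* Monotone convergence is applied along these intervals; [n.+1] makes the right end exceed [a], as
   [fC] requires. *)
pose F n := `[a, a + n.+1%:R]%classic.
have FE : `[a, +oo[%classic = \bigcup_n F n.
  apply/seteqP; split => [x /=|x [n _]]; rewrite /F /= !in_itv /= ?andbT.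
    move=> ax; exists (Num.truncn (x - a)) => //=; rewrite in_itv /= ax /=.
    have : 0 <= x - a by rewrite subr_ge0.
    by move/Num.Theory.truncn_itv/andP => [_ /ltW]; rewrite lerBlDl.
  by case/andP.
have sF n : F n `<=` `[a, +oo[ by rewrite FE; exact: bigcup_sup.
rewrite FE; have := @ge0_nondecreasing_set_cvg_integral _
  (measurableTypeR R) R F (EFin \o f) mu.
have H1 : nondecreasing_seq F.
  move=> m n mn; apply/subsetPset => x; rewrite /F /= !in_itv /=.
  case/andP => -> /= /le_trans; apply.
  by rewrite lerD2l ler_nat ltnS.
have H2 i x : F i x -> (0 <= (EFin \o f) x)%E.
  by rewrite /F /= in_itv /= lee_fin => /andP[? _]; exact: f0.
move/(_ H1 (fun i => measurable_itv _)) => H.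
have {}H := H (fun i => measurable_funS (measurable_itv _) (@sF i) mEf) H2.
rewrite -(cvg_lim _ H) //; apply: lime_le; first by apply/cvg_ex; eexists; exact: H.
by apply: nearW => n; apply: fC; rewrite ltrDl.
Qed.

(** The witness [P x] is the integral of [a] over [[T, x]]: nondecreasing and bounded by the total
    integral, so convergent. *)
Lemma ge0_integrable_primitive (T : R) (a : R -> R) :
  measurable_fun setT a -> (forall x, 0 <= a x) ->
  (\int[mu]_(t in `[T, +oo[) (a t)%:E < +oo)%E ->
  exists P : R -> R, exists l : R, [/\ P x @[x --> +oo] --> l,
    forall x, T <= x ->
      0 <= P x <= fine (\int[mu]_(t in `[T, +oo[) (a t)%:E)%E
    & forall x y, T <= x -> x <= y ->
      (\int[mu]_(t in `[x, y]) (a t)%:E = (P y - P x)%:E)%E].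
Proof.
move=> ma a0 aoo.
have mE D : measurable_fun D (EFin \o a).
  by apply/measurable_EFinP; apply: measurable_funS ma.
have aE0 (D : set R) x : D x -> (0 <= (a x)%:E)%E by rewrite lee_fin a0.
have fin : (\int[mu]_(t in `[T, +oo[) (a t)%:E)%E \is a fin_num.
  by rewrite ge0_fin_numE // integral_ge0 // => x _; rewrite lee_fin.
have le x y : T <= x ->
    (\int[mu]_(t in `[x, y]) (a t)%:E <= \int[mu]_(t in `[T, +oo[) (a t)%:E)%E.
  move=> Tx; apply: ge0_subset_integral => //; first exact: mE.
    by move=> t _; rewrite lee_fin.
  by move=> t /=; rewrite !in_itv /= andbT => /andP[/(le_trans Tx) -> _].
have finP x y : T <= x -> (\int[mu]_(t in `[x, y]) (a t)%:E)%E \is a fin_num.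
  move=> Tx; rewrite ge0_fin_numE ?(le_lt_trans (le _ _ Tx)) //.
  by apply: integral_ge0 => t _; rewrite lee_fin.
pose P x := fine (\int[mu]_(t in `[T, x]) (a t)%:E)%E.
have PE x y : T <= x -> x <= y ->
    (\int[mu]_(t in `[x, y]) (a t)%:E = (P y - P x)%:E)%E.
  move=> Tx xy; rewrite EFinB /P !fineK ?finP //.
  have -> : `[T, y]%classic = (`[T, x] `|` `]x, y])%classic :> set R.
    by rewrite -itv_bndbnd_setU.
  rewrite ge0_integral_setU //; last 3 first.
  - exact: mE.
  - by move=> t _; rewrite lee_fin.
  - apply/disj_setPS => t /= []; rewrite !in_itv /= => /andP[_ tx] /andP[xt _].
    by move: (lt_le_trans xt tx); rewrite ltxx.
  rewrite integral_itv_obnd_cbnd; last exact: mE.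
  by rewrite addeAC subee ?finP // add0e.
have P0 x : T <= x -> 0 <= P x <= fine (\int[mu]_(t in `[T, +oo[) (a t)%:E)%E.
  move=> Tx; rewrite /P fine_ge0 /=; last first.
    by apply: integral_ge0 => t _; rewrite lee_fin.
  by rewrite fine_le // ?finP // le.
have [l Pl] : exists l : R, P x @[x --> +oo] --> l.
  apply: (nondecreasing_itvy_cvg _ T _ _ (fun x Tx => proj2 (andP (P0 x Tx)))).
  move=> x y Tx xy; rewrite -subr_ge0 -lee_fin -PE //.
  by apply: integral_ge0 => t _; rewrite lee_fin.
by exists P, l; split.
Qed.

Lemma integral_is_derive (f f' : R -> R) (x y : R) :
  (forall t, is_derive t (1 : R) f (f' t)) -> continuous f' -> x < y ->
  (\int[mu]_(t in `[x, y]) (f' t)%:E = (f y - f x)%:E)%E.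
Proof.
move=> df cf' xy; rewrite EFinB.
have cf : continuous f.
  move=> t; apply/differentiable_continuous/derivable1_diffP.
  by have [] := df t.
apply: continuous_FTC2 => //.
- exact: continuous_subspaceT.
- split; first by move=> t _; have [] := df t.
  + exact: cvg_at_right_filter (cf x).
  + exact: cvg_at_left_filter (cf y).
- by move=> t _; rewrite derive1E; have [] := df t.
Qed.

(* If [a] has primitive [P] then [f + P] is nondecreasing and bounded. *)
Lemma almost_monotone_cvg (T M : R) (f f' a : R -> R) :
  (forall t, is_derive t (1 : R) f (f' t)) -> continuous f' ->
  (forall t, `|f t| <= M) ->
  measurable_fun setT a -> (forall t, 0 <= a t) ->
  (\int[mu]_(t in `[T, +oo[) (a t)%:E < +oo)%E ->
  (forall t, T <= t -> 0 <= f' t + a t) ->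
  (exists l : R, f x @[x --> +oo] --> l) /\
  (\int[mu]_(t in `[T, +oo[) (f' t + a t)%:E < +oo)%E.
Proof.
move=> df cf' fM ma a0 aoo fa0.
have [P [l [Pl P0 PE]]] := ge0_integrable_primitive T a ma a0 aoo.
set C := fine _ in P0.
have mf' : measurable_fun setT f' by exact: continuous_measurable_fun.
have GE x y : T <= x -> x < y ->
    (\int[mu]_(t in `[x, y]) (f' t + a t)%:E = ((f y + P y) - (f x + P x))%:E)%E.
  move=> Tx xy; under eq_integral do rewrite EFinD.
  rewrite integralD_EFin //=; last 2 first.
  - apply: continuous_compact_integrable; first exact: segment_compact.
    exact: continuous_subspaceT.
  - apply/integrableP; split.
      by apply/measurable_EFinP; apply: measurable_funS ma.
    under eq_integral do rewrite /= ger0_norm //.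
    by rewrite PE // ?ltry // ltW.
  by rewrite (integral_is_derive f) // PE ?(ltW xy) // -EFinD; congr EFin; ring.
have nd x y : T <= x -> x <= y -> f x + P x <= f y + P y.
  move=> Tx; rewrite le_eqVlt => /predU1P[->//|xy].
  rewrite -subr_ge0 -lee_fin -GE //; apply: integral_ge0 => t /=.
  by rewrite in_itv /= => /andP[xt _]; rewrite lee_fin fa0 // (le_trans Tx).
have fPM x : T <= x -> f x + P x <= M + C.
  by move=> /P0/andP[_ ?]; rewrite lerD // (le_trans (ler_norm _)).
split.
  have [k fPk] := nondecreasing_itvy_cvg (fun x => f x + P x) T _ nd fPM.
  exists (k - l); have -> : f = (fun x => f x + P x) \- P.
    by apply/funext => x /=; rewrite addrK.
  exact: cvgB.
(* By [GE] the integral over [[T, x]] is the increment of [f + P], bounded by this constant for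
   every [x]. *)
apply: (@le_lt_trans _ _ (M + C - (f T + P T))%:E); last exact: ltry.
apply: integral_itvy_le => [|x Tx|x Tx].
- by apply: measurable_funS (measurable_funD mf' ma).
- by rewrite fa0.
- by rewrite GE // lee_fin lerB // fPM // ltW.
Qed.

(* Barbalat's argument: [u t >= d] forces [u >= d / 2] on an interval to the
   right of [t] whose length does not depend on [t]. *)
Lemma lipschitz_square_integrable_cvg0 (T K : R) (u : R -> R) :
  (forall x, 0 <= u x) ->
  (forall x y, u x - u y <= K * `|x - y|) ->
  (\int[mu]_(t in `[T, +oo[) (u t ^+ 2)%:E < +oo)%E ->
  u x @[x --> +oo] --> 0.
Proof.
move=> u0 uK uoo.
have K1 : 0 < `|K| + 1 by rewrite ltr_wpDl.
have {}uK x y : u x - u y <= (`|K| + 1) * `|x - y|.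
  by rewrite (le_trans (uK x y)) // ler_wpM2r // ler_wpDr // ler_norm.
have mu_ : measurable_fun setT u.
  apply: continuous_measurable_fun => x; apply/cvgrPdist_le => _/posnumP[d].
  have /cvgrPdist_le : y @[y --> x] --> x by exact: cvg_id.
  have d0 : 0 < d%:num / (`|K| + 1) by rewrite divr_gt0.
  move=> /(_ _ d0); apply: filterS => y.
  rewrite ler_pdivlMr // mulrC => xy.
  rewrite ler_norml lerNl opprB; apply/andP; split; apply: le_trans xy => //.
  by rewrite distrC.
have [P [l [Pl _ PE]]] := ge0_integrable_primitive T (fun t => u t ^+ 2)
  (measurable_funX 2 mu_) (fun t => sqr_ge0 _) uoo.
apply/cvgrPdist_le => _/posnumP[d].
(* With Lipschitz constant [|K| + 1], [u] drops by at most [d / 2] over a length [s]; so if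
   [u t > d], the integral of [u ^+ 2] over [[t, t + s]] is at least the [r] below. *)
pose s := d%:num / (2 * (`|K| + 1)).
have s0 : 0 < s by rewrite divr_gt0 // mulr_gt0.
pose r := s * (d%:num / 2) ^+ 2.
have r0 : 0 < r / 3 by rewrite divr_gt0 // mulr_gt0 // exprn_gt0.
(* Beyond [A], [P] stays within [r / 3] of [l], so its increments stay below [2 r / 3], which
   contradicts [lo]. *)
have /cvgrPdist_lt /(_ _ r0) [A [_ HA]] := Pl.
exists (Num.max A T); split; first exact: num_real.
move=> t; rewrite gt_max => /andP[At /ltW Tt].
rewrite sub0r normrN ger0_norm // leNgt; apply/negP => ut.
have ts : t < t + s by rewrite ltrDl.
have lo : r <= P (t + s) - P t.
  rewrite -lee_fin -PE //; last exact: ltW.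
  have -> : (r%:E = \int[mu]_(x in `[t, (t + s)%R]) ((d%:num / 2) ^+ 2)%:E)%E.
    rewrite integral_cst //= lebesgue_measure_itv /= lte_fin ts -EFinD -EFinM.
    by congr EFin; rewrite /r; ring.
  apply: ge0_le_integral => //.
  - apply/measurable_EFinP; apply: measurable_funS (measurable_funX 2 mu_) => //.
  - move=> x /=; rewrite in_itv /= => /andP[tx xs]; rewrite lee_fin.
    rewrite lerXn2r // ?nnegrE //.
    have Hx : (`|K| + 1) * `|t - x| <= d%:num / 2.
      have : `|t - x| <= s by rewrite distrC ger0_norm ?subr_ge0 // lerBlDl.
      move/(ler_wpM2l (ltW K1)) => /le_trans; apply.
      rewrite le_eqVlt; apply/orP; left; apply/eqP.
      by rewrite /s; field; rewrite gt_eqF.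
    by have := uK t x; move: ut Hx; lra.
have H1 := HA _ At; have H2 := HA _ (lt_trans At ts).
move: lo H1 H2; rewrite /= !ltr_norml => lo /andP[a1 a2] /andP[b1 b2].
by move: lo r0; lra.
Qed.

End HalfLine.

(** * The diagonal flow for scalar families *)

Section DiagonalFlow.
Context {R : realType}.
Notation mu := (@lebesgue_measure R).
Variables (g h : nat -> nat -> R -> R).
Hypotheses (mg : forall i j, measurable_fun setT (g i j))
           (mh : forall i j, measurable_fun setT (h i j)).

Let w i j t := `|g i j t| * h i j t ^+ 2.

Let mw i j : measurable_fun setT (w i j).
Proof.
apply: measurable_funM; last exact/measurable_funX.
exact: measurableT_comp.
Qed.

Let mwE i j D : measurable_fun D (EFin \o w i j).
Proof. by apply/measurable_EFinP; apply: measurable_funS (mw i j). Qed.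

Let w_ge0 i j t : 0 <= w i j t.
Proof. by rewrite mulr_ge0 // sqr_ge0. Qed.

Lemma balanced_integral_lty (T : R) i j :
  balanced_family g -> balanced_family h ->
  (\int[mu]_(t in `[T, +oo[) (`|g j i t| * h j i t ^+ 2)%:E < +oo)%E ->
  (\int[mu]_(t in `[T, +oo[) (`|g i j t| * h i j t ^+ 2)%:E < +oo)%E.
Proof.
move=> /(_ i j)[c [_ c0 [M cM] gc]] /(_ i j)[c' [_ c'0 [M' c'M] hc]] ji.
(* Almost everywhere [c <= |M|] and [c' <= |M'|], and [h] enters squared; the absolute values make
   [K >= 0] immediate. *)
pose K := `|M| * `|M'| ^+ 2.
have K0 : 0 <= K by rewrite mulr_ge0 // sqr_ge0.
apply: (@le_lt_trans _ _ (\int[mu]_(t in `[T, +oo[) (K%:E * (w j i t)%:E))%E).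
  apply: ae_ge0_le_integral => //.
  - by move=> t _; rewrite lee_fin w_ge0.
  - exact: mwE.
  - by move=> t _; rewrite -EFinM lee_fin mulr_ge0.
  - apply/measurable_EFinP; apply: measurable_funM; first exact: measurable_cst.
    by apply: measurable_funS (mw j i).
  apply: (@filterS2 _ _ (ae_filter_ringOfSetsType mu) _ _ _ _ cM c'M).
  move=> t {}cM {}c'M _; rewrite -EFinM lee_fin.
  rewrite /w /K -mulrACA; apply: ler_pM; rewrite ?sqr_ge0 //.
    by rewrite (le_trans (gc t)) // ler_wpM2r // (le_trans cM) // ler_norm.
  rewrite -exprMn -(real_normK (num_real (h i j t))).
  rewrite -[X in _ <= X](real_normK (num_real _)) normrM normr_id.
  rewrite lerXn2r // ?nnegrE ?mulr_ge0 //.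
  by rewrite (le_trans (hc t)) // ler_wpM2r // (le_trans c'M) // ler_norm.
rewrite ge0_integralZl_EFin //; last 2 first.
- by move=> t _; rewrite lee_fin w_ge0.
- exact: mwE.
have fin : (\int[mu]_(t in `[T, +oo[) (w j i t)%:E)%E \is a fin_num.
  rewrite ge0_fin_numE //; apply: integral_ge0 => t _.
  by rewrite lee_fin w_ge0.
by rewrite -(fineK fin) -EFinM ltry.
Qed.

Hypotheses (gbal : balanced_family g) (hbal : balanced_family h).
Variables (d : nat -> R -> R) (T M : R) (eps : nat -> R).
Hypothesis dh : forall l t, is_derive t (1 : R) (h l l) (d l t).
Hypothesis cd : forall l, continuous (d l).
Hypothesis hM : forall l t, `|h l l t| <= M.
Hypothesis dE : forall l t,
  (fun N => \sum_(j < N) g l j t * h l j t ^+ 2) @ \oo --> d l t.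
Hypothesis eps1 : forall l, eps l = 1 \/ eps l = -1.
Hypothesis gs : forall t k l, T <= t -> (l <= k)%N -> 0 <= eps l * g l k t.

(* From index [l] on, the terms of the series for [eps l * d l t] equal
   [w l j t]; the [l] terms before that are at least [- w l j t]. *)
Let sum_weights_le l n t : T <= t ->
  \sum_(j < n) w l j t <= eps l * d l t + 2 * \sum_(j < l) w l j t.
Proof.
move=> Tt; rewrite -lerBlDr.
have epsd : (fun N => eps l * \sum_(j < N) g l j t * h l j t ^+ 2) @ \oo
    --> eps l * d l t.
  by apply: cvgM => //; exact: cvg_cst.
(* It suffices to bound the partial sums with [N >= maxn n l], which contain both the [n] terms on
   the left and the [l] exceptional ones. *)
apply: (cvgr_to_ge epsd); exists (maxn n l) => // N /=.
rewrite geq_max => /andP[nN lN].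
have epsg j : `|eps l * g l j t| = `|g l j t|.
  by rewrite normrM; case: (eps1 l) => ->; rewrite ?normrN normr1 mul1r.
rewrite lerBlDr; apply: (le_trans (y := \sum_(j < N) w l j t)).
  rewrite -(subnKC nN) big_split_ord /= lerDl.
  by apply: sumr_ge0 => j _; rewrite w_ge0.
rewrite -(subnKC lN) !big_split_ord /= mulrDr -addrA (addrC _ (2 * _)) addrA.
apply: lerD.
  rewrite !mulr_sumr -big_split /=; apply: ler_sum => j _.
  have := ler_norm (- (eps l * g l j t)); rewrite normrN epsg => H.
  have := ler_wpM2r (sqr_ge0 (h l j t)) H.
  by rewrite /w; lra.
rewrite mulr_sumr; apply: ler_sum => j _.
rewrite /w mulrA -epsg ger0_norm //; apply: gs => //.
by rewrite leq_addr.
Qed.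

Lemma diagonal_flow_converges l :
  (\sum_(0 <= j <oo) \int[mu]_(t in `[T, +oo[)
     (`|g l j t| * h l j t ^+ 2)%:E < +oo)%E
  /\ exists L : R, h l l t @[t --> +oo] --> L.
Proof.
elim/ltn_ind: l => l IH.
(* The integral of [w j l] is one term of the series for the earlier index [j], finite by induction;
   balance transfers this to [w l j]. *)
have IHw (j : 'I_l) : (\int[mu]_(t in `[T, +oo[) (w l j t)%:E < +oo)%E.
  apply: balanced_integral_lty => //; have [+ _] := IH j (ltn_ord j).
  apply: le_lt_trans.
  have w0 k : (0 <= \int[mu]_(t in `[T, +oo[) (w j k t)%:E)%E.
    by apply: integral_ge0 => t _; rewrite lee_fin w_ge0.
  have := @nneseries_lim_ge R
    (fun k => \int[mu]_(t in `[T, +oo[) (w j k t)%:E)%E xpredT 0%N l.+1.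
  rewrite big_mkord big_ord_recr /= => H; apply: le_trans (H _) => //.
  by rewrite leeDr // sume_ge0.
have msum n D : measurable_fun D (fun t => \sum_(j < n) w l j t).
  by apply: measurable_sum => j; apply: measurable_funS (mw l j).
pose a t := 2 * \sum_(j < l) w l j t.
have ma : measurable_fun setT a.
  apply: measurable_funM; first exact: measurable_cst.
  exact: msum.
have a0 t : 0 <= a t by rewrite mulr_ge0 // sumr_ge0.
have sumE n : (\int[mu]_(t in `[T, +oo[) (\sum_(j < n) w l j t)%:E
    = \sum_(j < n) \int[mu]_(t in `[T, +oo[) (w l j t)%:E)%E.
  rewrite -ge0_integral_sum //.
  - by apply: eq_integral => t _; rewrite sumEFin.
  - by move=> j; exact: mwE.
  - by move=> j t _; rewrite lee_fin w_ge0.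
have aoo : (\int[mu]_(t in `[T, +oo[) (a t)%:E < +oo)%E.
  under eq_integral do rewrite EFinM.
  rewrite ge0_integralZl_EFin //; last 2 first.
  - by move=> t _; rewrite lee_fin sumr_ge0.
  - apply/measurable_EFinP; exact: msum.
  by rewrite sumE lte_mul_pinfty ?lte_sum_pinfty ?lee_fin.
have df t : is_derive t (1 : R) (fun s => eps l * h l l s) (eps l * d l t).
  exact: is_deriveZ.
have cdf : continuous (fun t => eps l * d l t).
  by move=> t; apply: cvgM; [exact: cvg_cst|exact: cd].
have mfa : measurable_fun setT (fun t => eps l * d l t + a t).
  by apply: measurable_funD => //; exact: continuous_measurable_fun.
have fM t : `|eps l * h l l t| <= M.
  by rewrite normrM; case: (eps1 l) => ->; rewrite ?normrN normr1 mul1r.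
have fa t : T <= t -> 0 <= eps l * d l t + a t.
  by move=> Tt; have := sum_weights_le l 0 t Tt; rewrite big_ord0.
have [[L fL] foo] := almost_monotone_cvg T M _ _ a df cdf fM ma a0 aoo fa.
split.
  apply: le_lt_trans foo; apply: lime_le.
    apply: is_cvg_nneseries => j _ _; apply: integral_ge0 => t _.
    by rewrite lee_fin w_ge0.
  (* The bound on the integrated partial sums does not depend on [n], so it passes to the series. *)
  apply: nearW => n; rewrite big_mkord -sumE; apply: ge0_le_integral => //.
  - by move=> t _; rewrite lee_fin sumr_ge0.
  - apply/measurable_EFinP; exact: msum.
  - by apply/measurable_EFinP; apply: measurable_funS mfa.
  - move=> t /=; rewrite in_itv /= andbT lee_fin => Tt.
    exact: sum_weights_le.
exists (eps l * L).
have -> : h l l = (fun t => eps l * (eps l * h l l t)).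
  apply/funext => t; case: (eps1 l) => ->; first by rewrite !mul1r.
  by rewrite !mulN1r opprK.
by apply: cvgM; [exact: cvg_cst|].
Qed.

End DiagonalFlow.

(** * Conclusions for the operator curve *)

Theorem theorem1p1
  (R : realType) (V : completeNormedModType R) (ip : V -> V -> R)
  (e : nat -> V) (H H' : R -> V -> V) (g : nat -> nat -> R -> R)
  (T : R) (eps : nat -> R) :
  inner_product ip ->
  hilbert_basis ip e ->
  C1_HS e H H' ->
  let h := fun i j t => ip (H t (e i)) (e j) in
  (* (i) *)
  (exists M : R, forall t, hs_norm e (H t) <= M) ->
  (* (ii) *)
  balanced_family h ->
  (* (iii) *)
  (forall i j, measurable_fun setT (g i j)) ->
  pointwise_bounded_family g ->
  balanced_family g ->
  (forall i t, (fun N => \sum_(j < N) g i j t * h i j t ^+ 2) @ \oo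
                 --> derive1 (h i i) t) ->
  0 < T ->
  (forall l, eps l = 1 \/ eps l = -1) ->
  (forall t k l, T <= t -> (l <= k)%N -> 0 <= eps l * g l k t) ->
  (* first conclusion *)
  (forall l,
     (\sum_(0 <= j <oo)
        \int[lebesgue_measure]_(t in `[T, +oo[)
            (`|g l j t| * h l j t ^+ 2)%:E < +oo)%E
     /\ exists L : R, h l l t @[t --> +oo] --> L)
  /\
  (* second conclusion *)
  ((forall l, exists c : R, 0 < c /\
       forall j t, j != l -> T <= t -> c <= `|g l j t|) ->
   forall l,
     (\sum_(0 <= j <oo | j != l)
        \int[lebesgue_measure]_(t in `[T, +oo[) (h l j t ^+ 2)%:E
      = \int[lebesgue_measure]_(t in `[T, +oo[)
          (`|H t (e l) - h l l t *: e l| ^+ 2)%:E)%E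
     /\ (\int[lebesgue_measure]_(t in `[T, +oo[)
          (`|H t (e l) - h l l t *: e l| ^+ 2)%:E < +oo)%E)
  /\
  (* third conclusion *)
  ((forall l, exists c : R, 0 < c /\
       forall j t, j != l -> T <= t -> c <= `|g l j t|) ->
   (forall l, exists M : R, forall t, `|H' t (e l)| <= M) ->
   forall l, exists L : R,
     h l l t @[t --> +oo] --> L /\
     H t (e l) @[t --> +oo] --> L *: e l).
Proof.
move=> Hip He HC1 h [M HM] hbal mg gpb gbal dE T0 eps1 gs.
have hs t : (hs_norm2 e (H t) < +oo)%E by case: HC1 => /(_ t) [].
have ch i j : continuous (h i j) by exact: (C1_HS_continuous ip Hip e H H' HC1).
have mh i j : measurable_fun setT (h i j) by exact: continuous_measurable_fun.
have dh l t : is_derive t (1 : R) (h l l) (ip (H' t (e l)) (e l)).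
  exact: (C1_HS_is_derive ip Hip e H H' HC1).
have hM l t : `|h l l t| <= M.
  apply: (le_trans (cauchy_schwarz_ip _ Hip _ _)).
  rewrite (norm_basis _ Hip _ He) mulr1; apply: le_trans (HM t).
  exact: norm_le_hs_norm.
have dE' l t : (fun N => \sum_(j < N) g l j t * h l j t ^+ 2) @ \oo
    --> ip (H' t (e l)) (e l).
  have [_ <-] := dh l t; rewrite -derive1E; exact: dE.
have cd l : continuous (fun t => ip (H' t (e l)) (e l)).
  exact: (C1_HS_continuous_derive ip Hip e H H' HC1).
have diag := diagonal_flow_converges g h mg mh gbal hbal
  (fun l t => ip (H' t (e l)) (e l)) T M eps dh cd hM dE' eps1 gs.
split; first by [].
(* Proved separately, since the third conclusion also needs this integrability. *)
have off : (forall l, exists c : R, 0 < c /\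
       forall j t, j != l -> T <= t -> c <= `|g l j t|) ->
   forall l,
     (\sum_(0 <= j <oo | j != l)
        \int[lebesgue_measure]_(t in `[T, +oo[) (h l j t ^+ 2)%:E
      = \int[lebesgue_measure]_(t in `[T, +oo[)
          (`|H t (e l) - h l l t *: e l| ^+ 2)%:E)%E
     /\ (\int[lebesgue_measure]_(t in `[T, +oo[)
          (`|H t (e l) - h l l t *: e l| ^+ 2)%:E < +oo)%E.
  move=> gc l; have [c [c0 cg]] := gc l.
  (* Setting the diagonal term to 0 gives a sum over all indices, where sum and integral can be
     exchanged. *)
  pose q j t := if j != l then h l j t ^+ 2 else 0.
  have mq j D : measurable_fun D (fun t => (q j t)%:E).
    apply/measurable_EFinP; rewrite /q; case: (j != l); last exact: measurable_cst.
    apply: measurable_funS (measurable_funX 2 (mh l j)) => //.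
  have q0 j t : (0 <= (q j t)%:E)%E.
    by rewrite lee_fin /q; case: ifP => _; rewrite ?sqr_ge0.
  have qE : (\sum_(0 <= j <oo | j != l)
        \int[lebesgue_measure]_(t in `[T, +oo[) (h l j t ^+ 2)%:E
      = \sum_(0 <= j <oo) \int[lebesgue_measure]_(t in `[T, +oo[) (q j t)%:E)%E.
    rewrite eseries_mkcond; apply: eq_eseriesr => j _.
    rewrite /q; case: (j != l) => //.
    by rewrite integral0_eq.
  have eqE : (\sum_(0 <= j <oo | j != l)
        \int[lebesgue_measure]_(t in `[T, +oo[) (h l j t ^+ 2)%:E
      = \int[lebesgue_measure]_(t in `[T, +oo[)
          (`|H t (e l) - h l l t *: e l| ^+ 2)%:E)%E.
    rewrite qE -integral_nneseries //; last by move=> j; exact: mq.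
    apply: eq_integral => t _; rewrite -(parseval_proj_compl _ Hip _ He).
    rewrite [RHS]eseries_mkcond; apply: eq_eseriesr => j _.
    by rewrite /q; case: (j != l).
  split=> //; rewrite -eqE qE.
  pose S := (\sum_(0 <= j <oo) \int[lebesgue_measure]_(t in `[T, +oo[)
     (`|g l j t| * h l j t ^+ 2)%:E)%E.
  have w0 j t : (0 <= (`|g l j t| * h l j t ^+ 2)%:E)%E.
    by rewrite lee_fin mulr_ge0 // sqr_ge0.
  have mw j D : measurable_fun D (fun t => (`|g l j t| * h l j t ^+ 2)%:E).
    apply/measurable_EFinP; apply: (@measurable_funS _ _ _ _ setT) => //.
    apply: measurable_funM; last exact/measurable_funX.
    exact: measurableT_comp.
  have iw0 j : (0 <= \int[lebesgue_measure]_(t in `[T, +oo[)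
     (`|g l j t| * h l j t ^+ 2)%:E)%E by exact: integral_ge0.
  (* Off the diagonal [c <= |g l j t|], so [q j t] is at most [c^-1] times the weight already known
     to be summable. *)
  apply: (@le_lt_trans _ _ (c^-1%:E * S)%E).
    rewrite -nneseriesZl //; apply: lee_nneseries => j _.
      by move=> _; exact: integral_ge0.
    have ci : 0 <= c^-1 by rewrite invr_ge0 ltW.
    rewrite -ge0_integralZl_EFin //; last exact: mw.
    apply: ge0_le_integral => //.
    - exact: mq.
    - by apply: measurable_funeM; exact: mw.
    - move=> t /=; rewrite in_itv /= andbT => Tt; rewrite -EFinM lee_fin /q.
      case: ifP => jl; last by rewrite mulr_ge0 // mulr_ge0 // sqr_ge0.
      rewrite mulrA -[X in X <= _]mul1r ler_wpM2r ?sqr_ge0 //.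
      by rewrite mulrC ler_pdivlMr // mul1r; exact: cg.
  have [Soo _] := diag l; rewrite lte_mul_pinfty ?lee_fin ?invr_ge0 ?ltW //.
split=> // gc H'M l.
have [_ [L hL]] := diag l; exists L; split => //.
have [K HK] := H'M l.
pose u t := `|H t (e l) - h l l t *: e l|.
have u0 : u t @[t --> +oo] --> 0.
  apply: (lipschitz_square_integrable_cvg0 T K) => [x|x y|].
  - exact: normr_ge0.
  (* The off-diagonal parts at [x] and [y] differ by the projection of [H x (e l) - H y (e l)],
     which is no longer than that vector. *)
  - apply: le_trans (C1_HS_lipschitz _ Hip _ _ _ HC1 _ _ HK y x).
    apply: le_trans (lerB_dist _ _) _.
    apply: le_trans (norm_proj_compl _ Hip _ He _ l).
    rewrite (ipBl _ Hip) -/(h l l x) -/(h l l y) scalerBl.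
    rewrite le_eqVlt; apply/orP; left; apply/eqP; congr `|_|.
    by rewrite !opprB addrACA [RHS]addrACA [in RHS](addrC (- _)) addrA.
  - by have [] := off gc l.
apply/cvgrPdist_le => _/posnumP[d].
have d2 : 0 < d%:num / 2 by rewrite divr_gt0.
move/cvgrPdist_le : u0 => /(_ _ d2); move/cvgrPdist_le : hL => /(_ _ d2).
apply: filterS2 => t Ht; rewrite sub0r normrN normr_id => ut.
(* The error splits into a diagonal and an off-diagonal part, each at most [d / 2]. *)
have -> : L *: e l - H t (e l)
    = (L - h l l t) *: e l - (H t (e l) - h l l t *: e l).
  by rewrite scalerBl opprB addrA subrK.
apply: (le_trans (ler_normB _ _)).
rewrite normrZ (norm_basis _ Hip _ He) mulr1.
by rewrite (splitr d%:num) lerD.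
Qed.
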